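(* There exist constants $\delta,\gamma>0$ such that for every large enough $n$ there is a triangle-free graph on $n$ vertices with minimum degree at least $\delta\sqrt{n}$ that contains no semi-bipartite induced subgraph of minimum degree at least $\gamma\log n$.
   Context: Given a graph $G=(V,E)$, an induced subgraph $G'=G[V']$ (with $V'\neq\emptyset$) is semi-bipartite if it admits a partition $V'=V_1\cup V_2$ such that $V_1$ is a stable set of $G$. The degree of a vertex of $G'$ with respect to the semi-bipartition is its degree in the bipartite graph $G[V_1,V_2]$ consisting of the edges of $G$ between $V_1$ and $V_2$ (edges inside $V_2$ are ignored), and the minimum degree of the semi-bipartite induced subgraph is the minimum of these degrees over $V'$. Thus the graph contains a semi-bipartite induced subgraph of minimum degree at least $t$ iff there are disjoint $V_1,V_2$, not both empty, with $V_1$ stable, such that every vertex of $V_1\cup V_2$ has at least $t$ neighbours on the other side. $\log$ is the natural logarithm. *)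

(* Defs.v *)
From HB Require Import structures.
From mathcomp Require Import all_boot all_order all_algebra.
From mathcomp Require Import reals exp.
Set Implicit Arguments.
Unset Strict Implicit.
Unset Printing Implicit Defensive.
Import Order.TTheory GRing.Theory Num.Theory.
Local Open Scope ring_scope.

(* Graphs on a finite vertex type T are represented by their adjacency
   relation. *)
Definition simple_graph (T : finType) (e : rel T) : Prop :=
  symmetric e /\ irreflexive e.

Definition triangle_free (T : finType) (e : rel T) : Prop :=
  forall x y z : T, ~ [/\ e x y, e y z & e x z].

Definition stable (T : finType) (e : rel T) (A : {set T}) : Prop :=
  forall x y : T, x \in A -> y \in A -> ~~ e x y.

Definition degree (T : finType) (e : rel T) (v : T) : nat :=
  #|[set u | e v u]|.

(* Degrees are taken in the whole graph e, not in its restriction to A. *)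
Definition min_degree_ge (R : realType) (T : finType) (e : rel T)
    (A : {set T}) (t : R) : Prop :=
  forall v : T, v \in A -> t <= (degree e v)%:R.

(* The bipartite graph G[V1, V2]: edges inside V1 or inside V2 are dropped. *)
Definition bip (T : finType) (e : rel T) (V1 V2 : {set T}) : rel T :=
  [rel x y | e x y &&
     ((x \in V1) && (y \in V2) || (x \in V2) && (y \in V1))].

(* V1 is the stable side; either side may be empty. *)
Definition semi_bipartition (T : finType) (e : rel T)
    (V' V1 V2 : {set T}) : Prop :=
  [/\ V1 :|: V2 = V', [disjoint V1 & V2] & stable e V1].

Definition has_semi_bipartite_induced (R : realType) (T : finType)
    (e : rel T) (t : R) : Prop :=
  exists V' : {set T}, V' != set0 /\
    exists V1 V2 : {set T},
      semi_bipartition e V' V1 V2 /\ min_degree_ge (bip e V1 V2) V' t.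

(* Main.v *)
Require Import Defs.
From HB Require Import structures.
From mathcomp Require Import all_boot all_order all_algebra.
From mathcomp Require Import reals exp zify.
(* Take the binomial random graph of edge probability 1/m with m of order
   sqrt n, fix an inclusion-maximal family of edge-disjoint triangles, and delete
   all their edges: the rest is triangle-free by maximality.  For a fixed set D
   of pairs, the number of edges in D is concentrated, while the edge-disjoint
   triangles meeting D are few by a first-moment bound (edge-disjointness makes
   their appearances independent).  With D the pairs at a vertex this gives
   minimum degree of order sqrt n; with D the pairs inside a k-set, k of order
   sqrt n log n, it shows that stable sets have fewer than k vertices.  Finally,
   in the graph before deletion, two sets A and B of equal size a < k span fewer
   than C a log n edges between them, since the expected number is a^2 / m.  A
   semi-bipartite subgraph with parts V1 and V2 and minimum degree at least
   C log n would contradict this with A = V1, which is stable, and B a subset or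
   superset of V2 of size |V1|. *)

Set Implicit Arguments.
Unset Strict Implicit.
Unset Printing Implicit Defensive.
Import Order.TTheory GRing.Theory Num.Theory.
Local Open Scope ring_scope.

Local Open Scope nat_scope.

(** * Elementary bounds on powers and binomials, and sets of prescribed size *)

Lemma bernoulli_expn (q j : nat) : q ^ j.+1 + j.+1 * q ^ j <= q.+1 ^ j.+1.
Proof.
elim: j => [|j IHj]; first by rewrite expn0 !expn1; lia.
rewrite [q.+1 ^ _]expnS (leq_trans _ (leq_mul (leqnn q.+1) IHj)) //.
rewrite [q ^ j.+2]expnS [q ^ j.+1]expnS; nia.
Qed.

Lemma expn_leq_ffact (n M : nat) : n ^ M <= (n + M) ^_ M.
Proof.
elim: M => [|M IHM]; first by rewrite expn0 ffactn0.
by rewrite addnS ffactSS expnS leq_mul // ltnW // ltnS leq_addr.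
Qed.

Lemma bin_leq_exp2 (n k : nat) : 'C(n, k) <= 2 ^ n.
Proof.
rewrite -[in X in 'C(X, _)](card_ord n) -cardsT -cards_draws.
rewrite -[in X in _ <= 2 ^ X](card_ord n) -[in X in _ <= 2 ^ X]cardsT.
rewrite -card_powerset subset_leq_card //; apply/subsetP=> A _.
by rewrite powersetE subsetT.
Qed.

Lemma bin_fact_leq_exp (n k : nat) : 'C(n, k) * k`! <= n ^ k.
Proof.
rewrite bin_ffact; elim: k n => [|k IHk] [|n] //.
rewrite ffactSS expnS leq_mul // (leq_trans (IHk n)) //.
by case: k {IHk} => // k; rewrite leq_exp2r.
Qed.

Lemma bin_leq_exp (n k : nat) : 'C(n, k) <= n ^ k.
Proof.
by apply: leq_trans (bin_fact_leq_exp n k); rewrite leq_pmulr ?fact_gt0.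
Qed.

(** A crude Stirling bound: [M ^ M] is at most the falling factorial ['C(2M, M) * M!]. *)
Lemma expn_self_leq_fact (M : nat) : M ^ M <= 4 ^ M * M`!.
Proof.
apply: leq_trans (expn_leq_ffact M M) _; rewrite -bin_ffact leq_mul //.
by rewrite (leq_trans (bin_leq_exp2 _ _)) // addnn -mul2n expnM.
Qed.

Lemma subset_of_card (T : finType) (A : {set T}) (k : nat) :
  k <= #|A| -> exists2 B : {set T}, B \subset A & #|B| = k.
Proof.
rewrite -bin_gt0 -cards_draws card_gt0 => /set0Pn[B].
by rewrite inE => /andP[sBA /eqP cB]; exists B.
Qed.

Lemma superset_of_card (T : finType) (A : {set T}) (k : nat) :
  #|A| <= k <= #|T| -> exists2 B : {set T}, A \subset B & #|B| = k.
Proof.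
case/andP=> leAk lekT.
have [|C sCA cC] := @subset_of_card T (~: A) (#|T| - k).
  by have := cardsC A; lia.
exists (~: C); first by rewrite subsetC.
by have := cardsC C; rewrite cC; lia.
Qed.

Lemma leq_card_bigcup (I T : finType) (J : {pred I}) (B : I -> {set T}) :
  #|\bigcup_(i in J) B i| <= \sum_(i in J) #|B i|.
Proof.
elim/big_rec2: _ => [|i a A _ leA]; first by rewrite cards0.
by rewrite (leq_trans (leq_card_setU _ _)) // leq_add2l.
Qed.

(** * Random subsets *)

Section RandomSet.

Variables (E : finType) (m' : nat).
Local Notation m := m'.+1.

(* A uniform element of [sample] encodes a random subset of [E] in which each
   element is present independently with probability [1 / m]. *)
Definition sample := {ffun E -> 'I_m}.

Definition present (f : sample) : {set E} := [set e | f e == ord0].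

(* The event [B] has probability at most [2 ^ (- c)]. *)
Definition rare (c : nat) (B : {set sample}) := #|B| * 2 ^ c <= m ^ #|E|.

Lemma card_sample : #|{: sample}| = m ^ #|E|.
Proof. by rewrite card_ffun card_ord. Qed.

Lemma rareW c d B : d <= c -> rare c B -> rare d B.
Proof. by move=> ledc; apply: leq_trans; rewrite leq_mul // leq_exp2l. Qed.

Lemma rare_sub c (A B : {set sample}) : A \subset B -> rare c B -> rare c A.
Proof. by move=> sAB; apply: leq_trans; rewrite leq_mul // subset_leq_card. Qed.

Lemma rare_bigcup (I : finType) (J : {set I}) (B : I -> {set sample}) j c :
  #|J| <= 2 ^ j -> (forall i, i \in J -> rare (j + c) (B i)) ->
  rare c (\bigcup_(i in J) B i).
Proof.
move=> leJ rB; rewrite /rare.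
rewrite -(@leq_pmul2l (2 ^ j)) ?expn_gt0 // mulnCA.
apply: leq_trans (leq_mul (leq_card_bigcup _ _) (leqnn _)) _.
rewrite -expnD big_distrl /=.
apply: (@leq_trans (\sum_(i in J) m ^ #|E|)); first exact: leq_sum.
by rewrite sum_nat_const leq_mul.
Qed.

Lemma rareU c (A B : {set sample}) :
  rare c.+1 A -> rare c.+1 B -> rare c (A :|: B).
Proof.
rewrite /rare expnS => rA rB.
have := leq_mul (leq_card_setU A B) (leqnn (2 ^ c)); rewrite mulnDl; lia.
Qed.

Lemma rare_exists (B : {set sample}) : rare 1 B -> exists f, f \notin B.
Proof.
move=> rB; apply/existsP; apply: contraLR rB.
rewrite negb_exists => /forallP allB; rewrite /rare -ltnNge.
have ->: #|B| = m ^ #|E|.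
  rewrite -card_sample -cardsT; apply: eq_card => f.
  by have := allB f; rewrite negbK inE.
by rewrite -[X in X < _]muln1 ltn_pmul2l // expn_gt0.
Qed.

Lemma card_present (C : {set E}) :
  #|[set f : sample | C \subset present f]| * m ^ #|C| = m ^ #|E|.
Proof.
pose F (e : E) : pred 'I_m := if e \in C then pred1 ord0 else predT.
have ->: #|[set f : sample | C \subset present f]| = \prod_(e : E) #|F e|.
  transitivity #|family F|; last by rewrite card_family foldrE big_map big_enum.
  apply: eq_card => f; rewrite inE.
  apply/subsetP/familyP => [sC e | famf e eC].
    by rewrite /F; case: ifP => // /sC; rewrite !inE.
  by have := famf e; rewrite /F eC !inE.
rewrite (bigID (mem C)) /= big1 => [|e eC]; last by rewrite /F eC card1.
rewrite mul1n (eq_bigr (fun=> m)) => [|e /negbTE eC]; last first.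
  by rewrite /F eC card_ord.
by rewrite prod_nat_const -expnD -(cardC C) addnC.
Qed.

(* First moment: there are at most [#|F| ^ M / M!] candidate families, and the
   disjointness makes each of them present with probability [m ^ (- s M)]. *)
Lemma rare_packing (F : {set {set E}}) (s M : nat) :
    {in F, forall C : {set E}, #|C| = s} -> 8 * #|F| <= M * m ^ s ->
  rare M [set f | [exists Q : {set {set E}},
    [&& Q \subset F, #|Q| == M, trivIset Q & cover Q \subset present f]]].
Proof.
move=> cF leF.
pose J := [set Q : {set {set E}} | [&& Q \subset F, #|Q| == M & trivIset Q]].
pose B (Q : {set {set E}}) := [set f : sample | cover Q \subset present f].
set A := [set f | _].
have sA: A \subset \bigcup_(Q in J) B Q.
  apply/subsetP=> f; rewrite inE => /existsP[Q /and4P[sQ cQ tQ pQ]].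
  by apply/bigcupP; exists Q; rewrite inE ?sQ ?cQ.
have cB Q : Q \in J -> #|B Q| * m ^ (s * M) = m ^ #|E|.
  rewrite inE => /and3P[/subsetP sQ /eqP cQ /eqP tQ].
  rewrite -(card_present (cover Q)) -tQ; congr (_ * m ^ _).
  by rewrite (eq_bigr (fun=> s)) => [|C /sQ /cF //]; rewrite sum_nat_const cQ mulnC.
have cJ: #|J| <= 'C(#|F|, M).
  rewrite -cards_draws subset_leq_card //; apply/subsetP=> Q.
  by rewrite !inE => /and3P[-> ->].
have leA: #|A| * m ^ (s * M) <= 'C(#|F|, M) * m ^ #|E|.
  apply: leq_trans (leq_mul (subset_leq_card sA) (leqnn _)) _.
  apply: leq_trans (leq_mul (leq_card_bigcup _ _) (leqnn _)) _.
  rewrite big_distrl /= (eq_bigr _ cB) sum_nat_const leq_mul //.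
case: (posnP M) => [M0 | M_gt0].
  by rewrite /rare M0 muln1 -card_sample max_card.
(* Clearing denominators. The 8 of the hypothesis is the 4 of the factorial bound times the 2 of the
   target [2 ^ M]. *)
rewrite /rare -(@leq_pmul2r (m ^ (s * M) * M ^ M)) ?muln_gt0 ?expn_gt0 ?M_gt0 //.
have step: 'C(#|F|, M) * M ^ M <= (4 * #|F|) ^ M.
  apply: leq_trans (leq_mul (leqnn _) (expn_self_leq_fact M)) _.
  by rewrite mulnCA expnMn leq_mul // bin_fact_leq_exp.
have ->: #|A| * 2 ^ M * (m ^ (s * M) * M ^ M)
       = #|A| * m ^ (s * M) * (2 ^ M * M ^ M) by lia.
apply: leq_trans (leq_mul leA (leqnn _)) _.
have ->: 'C(#|F|, M) * m ^ #|E| * (2 ^ M * M ^ M)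
       = m ^ #|E| * (2 ^ M * ('C(#|F|, M) * M ^ M)) by lia.
rewrite leq_mul2l; apply/orP; right.
apply: leq_trans (leq_mul (leqnn _) step) _.
by rewrite expnM -!expnMn leq_exp2r // mulnA [_ * M]mulnC.
Qed.

(* Markov's inequality for [2 ^ #|P :\: present f|], whose mean factorises. *)
Lemma rare_few_present (P : {set E}) (x : nat) : 4 * m * x <= #|P| ->
  rare x [set f | #|P :&: present f| <= x].
Proof.
move=> leP; set A := [set f | _]; set N := #|P|.
have lexN: x <= N by apply: leq_trans leP; rewrite -mulnA; nia.
(* An element of [P] contributes weight 1 for the value 0 and 2 for each of the [m'] others, in
   total [2 * m' + 1]; any other element contributes [m]. *)
have mean: \sum_(f : sample) 2 ^ #|P :\: present f|
         = (2 * m').+1 ^ N * m ^ (#|E| - N).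
  pose F (e : E) (j : 'I_m) := if (e \in P) && (j != ord0) then 2 else 1.
  rewrite (eq_bigr (fun f : sample => \prod_e F e (f e))) => [|f _]; last first.
    have ->: 2 ^ #|P :\: present f| = \prod_(e in P :\: present f) 2.
      by rewrite prod_nat_const.
    rewrite big_mkcond /=; apply: eq_bigr => e _.
    by rewrite /F !inE andbC.
  rewrite -(bigA_distr_bigA F) (bigID (mem P)) /=; congr (_ * _).
    rewrite -prod_nat_const; apply: eq_bigr => e eP.
    rewrite big_ord_recl /F eP /= (eq_bigr (fun=> 2)) // sum_nat_const card_ord.
    by lia.
  rewrite (eq_bigr (fun=> m)) => [|e /negbTE eP]; last first.
    by rewrite /F eP /= sum_nat_const card_ord muln1.
  by rewrite prod_nat_const -(cardC P) addKn.
have markov: #|A| * 2 ^ (N - x) <= (2 * m').+1 ^ N * m ^ (#|E| - N).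
  rewrite -mean (bigID (mem A)) /= -[X in X <= _]addn0 leq_add //.
  rewrite -sum_nat_const leq_sum // => f; rewrite inE => lef.
  by rewrite leq_exp2l //; have := cardsID (present f) P; rewrite -/N; lia.
(* Since [(1 - 1/(2m)) ^ (2m) <= 1/2] and [N >= 2m * 2x], there are [2x] halvings: [x] of them
   offset the [2 ^ x] lost in Markov's bound, the others give the claim. *)
have decay: (2 * m').+1 ^ N * 2 ^ (2 * x) <= (2 * m) ^ N.
  have [d ->]: exists d, N = (2 * m) * (2 * x) + d.
    by exists (N - 4 * m * x); move: leP; rewrite -/N; lia.
  rewrite !(expnD _ (2 * m * _)) mulnAC leq_mul //; last first.
    by case: d => // d; rewrite leq_exp2r //; lia.
  rewrite !(expnM _ (2 * m)) -expnMn; case: (2 * x) => // y; rewrite leq_exp2r //.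
  have ->: 2 * m = (2 * m').+2 by lia.
  have := bernoulli_expn (2 * m').+1 (2 * m').+1; set q := (2 * m').+1.
  by rewrite [q ^ q.+1]expnS mulSn; move: (q ^ q) (q.+1 ^ q.+1) => w z; lia.
have leNE: N <= #|E| by apply: max_card.
rewrite /rare -(@leq_pmul2r (2 ^ N)) ?expn_gt0 //.
have ->: #|A| * 2 ^ x * 2 ^ N = #|A| * 2 ^ (N - x) * 2 ^ (2 * x).
  by rewrite -!mulnA -!expnD; congr (_ * 2 ^ _); lia.
apply: leq_trans (leq_mul markov (leqnn _)) _.
rewrite mulnAC (leq_trans (leq_mul decay (leqnn _))) //.
by rewrite expnMn -mulnA -expnD subnKC // mulnC.
Qed.

End RandomSet.

(** * Graphs as sets of vertex pairs *)

Section PairSets.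

Variable T : finType.
Implicit Types (u v : T) (S A B : {set T}) (X D : {set {set T}}).
Implicit Types (P Q : {set {set {set T}}}).

(* Members of [X] that are not two-element sets are ignored. *)
Definition adj X : rel T := [rel u v | (u != v) && ([set u; v] \in X)].

Definition pairs S : {set {set T}} :=
  [set p : {set T} | p \subset S & #|p| == 2].

(** A triangle is encoded by its set of three edges, so that edge-disjointness of a family is
    [trivIset]. *)
Definition triangles : {set {set {set T}}} := 
  [set pairs t | t in [set t : {set T} | #|t| == 3]].

Definition triangles_meeting D := [set C in triangles | ~~ [disjoint C & D]].

Definition packing X Q := [&& Q \subset triangles, trivIset Q & cover Q \subset X].

Definition star v := [set [set v; u] | u in [set~ v]].

(** [A] and [B] may overlap, which produces singletons and repeated pairs; the upper bound
    [#|A| * #|B|] on the size survives. *)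
Definition cross A B := [set [set x.1; x.2] | x in setX A B].

Lemma adj_simple X : simple_graph (adj X).
Proof. by split=> [u v | u]; rewrite /adj /= ?eqxx // eq_sym setUC. Qed.

Lemma card_pairs S : #|pairs S| = 'C(#|S|, 2).
Proof. exact: cards_draws. Qed.

Lemma pair_in_pairs S u v :
  u \in S -> v \in S -> u != v -> [set u; v] \in pairs S.
Proof.
by move=> uS vS neq; rewrite inE cards2 neq eqxx andbT subUset !sub1set uS.
Qed.

Lemma set2_inj v : {in [set~ v] &, injective (fun u : T => [set v; u])}.
Proof.
move=> u w; rewrite !inE => neu _ /setP/(_ u).
by rewrite !inE eqxx orbT (negbTE neu) => /esym/eqP.
Qed.

Lemma card_star v : #|star v| = #|T|.-1.
Proof. by rewrite card_in_imset ?cardsC1 //; apply: set2_inj. Qed.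

Lemma star_pairs v : star v \subset pairs setT.
Proof.
apply/subsetP=> p /imsetP[u]; rewrite !inE => neu ->.
by rewrite subsetT cards2 [v == u]eq_sym neu.
Qed.

Lemma card_star_degree X v : #|star v :&: X| <= degree (adj X) v.
Proof.
apply: leq_trans (leq_imset_card (fun u => [set v; u]) [set u | adj X v u]).
apply/subset_leq_card/subsetP => p /setIP[/imsetP[u neu ->] uX].
by apply: imset_f; move: neu; rewrite !inE /adj /= uX andbT eq_sym.
Qed.

Lemma card_triangle C : C \in triangles -> #|C| = 3.
Proof. by case/imsetP=> t; rewrite inE => /eqP ct ->; rewrite card_pairs ct. Qed.

(** Such a triangle is determined by one of its edges in [D] and its third vertex. *)
Lemma card_triangles_meeting D : D \subset pairs setT ->
  #|triangles_meeting D| <= #|D| * #|T|.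
Proof.
move=> /subsetP sD.
rewrite -cardsT -cardsX.
apply: leq_trans (leq_imset_card (fun x => pairs (x.2 |: x.1)) (setX D setT)).
apply/subset_leq_card/subsetP => C.
rewrite inE -setI_eq0 => /andP[/imsetP[t]]; rewrite inE => /eqP ct -> {C}.
case/set0Pn=> p /setIP[]; rewrite inE => /andP[spt /eqP cp] pD.
have /cards1P[w tw]: #|t :\: p| == 1 by rewrite cardsD (setIidPr spt) ct cp.
apply/imsetP; exists (p, w); first by rewrite inE pD inE.
by congr pairs; rewrite /= -tw setUC -{1}(setIidPr spt) setID.
Qed.

Lemma packing_triangle_free X :
  exists Q, packing X Q /\ triangle_free (adj (X :\: cover Q)).
Proof.
have pk0: packing X set0.
  by rewrite /packing sub0set /trivIset /cover !big_set0 cards0 sub0set.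
have [Q /maxsetP[pkQ maxQ] _] := maxset_exists pk0.
exists Q; split=> // x y z [/andP[nxy hxy] /andP[nyz hyz] /andP[nxz hxz]].
pose C := pairs [set x; y; z].
have xy_C: [set x; y] \in C by rewrite pair_in_pairs // !inE eqxx ?orbT.
have sCH: C \subset X :\: cover Q.
  apply/subsetP=> p; rewrite inE => /andP[sp /cards2P[u [v [nuv ep]]]].
  move: sp; rewrite {p}ep subUset !sub1set !inE.
  case/andP=> /orP[/orP[]|] /eqP eu /orP[/orP[]|] /eqP ev;
    move: nuv; rewrite eu ev ?eqxx // => _ //; rewrite 1?setUC -?in_setD //;
    by rewrite setUC.
have C_tri: C \in triangles.
  apply/imset_f; rewrite inE -setUA cardsU1 cards2 nyz !inE negb_or nxy nxz.
  by [].
case/and3P: (pkQ) => sQ tQ cQ.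
(* A surviving triangle could be added to [Q]; maximality then puts it in [Q], although its edges
   avoid [cover Q]. *)
have pkC: packing X (C |: Q).
  apply/and3P; split.
  - by rewrite subUset sub1set C_tri.
  - have disC (B : {set {set T}}) : B \in Q -> [disjoint C & B].
      move=> BQ; rewrite disjoint_sym disjoint_subset; apply/subsetP=> p pB.
      apply/negP=> /(subsetP sCH); rewrite inE => /andP[/negP[]].
      by apply/bigcupP; exists B.
    apply/trivIsetP=> /= A B /setU1P[->|AQ] /setU1P[->|BQ] neAB.
    + by rewrite eqxx in neAB.
    + exact: disC.
    + by rewrite disjoint_sym disC.
    + exact: (trivIsetP tQ).
  - rewrite /cover bigcup_setU big_set1 subUset cQ andbT.
    by rewrite (subset_trans sCH) ?subsetDl.
have CQ: C \in Q by rewrite -(maxQ _ pkC (subsetUr _ _)) setU11.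
move/subsetP/(_ _ xy_C): sCH; rewrite inE => /andP[/negP[]].
by apply/bigcupP; exists C.
Qed.

(** [M] members of [Q] meeting [D] would form the excluded [P]. So fewer than [M] meet it, and with
    three edges each they destroy fewer than [3 * M] pairs of [D]. *)
Lemma packing_survivors X Q D (M : nat) : packing X Q ->
    ~~ [exists P : {set {set {set T}}}, [&& P \subset triangles_meeting D,
         #|P| == M, trivIset P & cover P \subset X]] ->
    4 * M < #|D :&: X| ->
  M < #|D :&: (X :\: cover Q)|.
Proof.
case/and3P=> /subsetP sQ tQ cQ noP ltD.
pose QD := [set C in Q | ~~ [disjoint C & D]].
have sQD: QD \subset Q by apply/subsetP=> C /setIdP[].
have ltQD: #|QD| < M.
  rewrite ltnNge; apply/negP=> /subset_of_card[P sP cP].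
  have sPQ := subset_trans sP sQD.
  case/existsP: noP; exists P; rewrite cP eqxx (trivIsetS sPQ tQ) /=.
  apply/andP; split.
    apply/subsetP=> C /(subsetP sP); rewrite !inE => /andP[/sQ -> //].
  apply: subset_trans cQ; apply/bigcupsP=> C /(subsetP sPQ) CQ.
  exact: bigcup_sup.
have lost: #|D :&: cover Q| <= 3 * #|QD|.
  apply: (@leq_trans #|cover QD|).
    apply/subset_leq_card/subsetP => p /setIP[pD /bigcupP[C CQ pC]].
    apply/bigcupP; exists C => //; rewrite inE CQ -setI_eq0.
    by apply/set0Pn; exists p; rewrite inE pC.
  apply: leq_trans (leq_card_cover _) _.
  rewrite (eq_bigr (fun=> 3)) ?sum_nat_const 1?mulnC // => C /(subsetP sQD)/sQ.
  exact: card_triangle.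
have := cardsID (cover Q) (D :&: X); rewrite setIDA.
have := subset_leq_card (setSI (cover Q) (subsetIl D X)).
by lia.
Qed.

Lemma crossC A B : cross A B = cross B A.
Proof.
by apply/setP=> p; apply/imsetP/imsetP=> -[[u v] /setXP[/= uA vB] ->];
  exists (v, u); rewrite ?inE /= ?uA ?vB // setUC.
Qed.

Lemma leq_card_cross X A B (t : nat) : [disjoint A & B] ->
    (forall v, v \in A -> t <= #|[set u in B | adj X v u]|) ->
  t * #|A| <= #|cross A B :&: X|.
Proof.
move=> dAB degA; pose Z := [set x in setX A B | adj X x.1 x.2].
have sep u v : u \in A -> v \in B -> u == v = false.
  by move=> uA vB; apply: contraTF vB => /eqP <-; rewrite (disjointFr dAB uA).
apply: (@leq_trans #|Z|).
  rewrite mulnC -sum_nat_const -sum1_card (eq_bigl (fun x : T * T =>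
    (x.1 \in A) && ((x.2 \in B) && adj X x.1 x.2))); last first.
    by move=> x; rewrite !inE -!andbA.
  rewrite -(pair_big_dep (mem A) (fun u v => (v \in B) && adj X u v)
    (fun _ _ => 1)) /= leq_sum // => v vA.
  rewrite sum1dep_card; apply: leq_trans (degA v vA) _.
  by apply/subset_leq_card/subsetP=> u; rewrite !inE.
rewrite -(card_in_imset (f := fun x : T * T => [set x.1; x.2])).
  apply/subset_leq_card/subsetP => p /imsetP[x /setIdP[xZ /andP[_ xX]] ->].
  by rewrite inE xX andbT; apply: imset_f.
move=> [u v] [u' v'] /setIdP[/setXP[/= uA vB] _] /setIdP[/setXP[/= uA' vB'] _].
move=> /setP eq2; move: (eq2 u) (eq2 v); rewrite !inE !eqxx orbT /=.
rewrite (sep u v') // [v == u']eq_sym (sep u' v) // orbF /=.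
by move=> /esym/eqP -> /esym/eqP ->.
Qed.

(* Cutting down or enlarging [V2] keeps [t] edges per vertex of [V1]. *)
Lemma semi_bipartite_cross X (V1 V2 : {set T}) (t : nat) :
    [disjoint V1 & V2] ->
    (forall v, v \in V1 :|: V2 -> t <= degree (bip (adj X) V1 V2) v) ->
  exists2 B : {set T}, #|B| = #|V1| & t * #|V1| <= #|cross V1 B :&: X|.
Proof.
move=> dV degV.
have [leV | /ltnW leV] := leqP #|V1| #|V2|.
  have [B sB cB] := subset_of_card leV; exists B => //.
  (* Edges are counted from [B], whose vertices keep all their neighbours in [V1]. *)
  rewrite crossC -cB leq_card_cross // => [|v vB].
    by rewrite disjoint_sym (disjointWr sB).
  have vV := subsetP sB v vB.
  apply: leq_trans (degV v _) _; first by rewrite inE vV orbT.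
  apply/subset_leq_card/subsetP => u; rewrite !inE /bip /= vV.
  by rewrite (disjointFl dV vV) andbC.
have [|B sB cB] := @superset_of_card T V2 #|V1|; first by rewrite leV max_card.
exists B => //; apply: (@leq_trans #|cross V1 V2 :&: X|); last first.
  apply/subset_leq_card/setSI/imsetS/subsetP=> x.
  by rewrite !inE => /andP[-> /(subsetP sB) ->].
apply: leq_card_cross => // v vV.
apply: leq_trans (degV v _) _; first by rewrite inE vV.
apply/subset_leq_card/subsetP => u; rewrite !inE /bip /= vV.
by rewrite (disjointFr dV vV) orbF andbC.
Qed.

End PairSets.

(** * Rare events in the random graph, and the choice of a good sample *)

Section RandomGraph.

Variables (T : finType) (m' : nat).
Local Notation m := m'.+1.
Local Notation sample := (sample {set T} m').

(* The condition on [m] makes the expected number of triangles meeting [D], at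
   most [#|D| * #|T| / m ^ 3], small compared to the expected number
   [#|D| / m] of edges in [D]. *)
Lemma rare_few_survivors (D : {set {set T}}) (M : nat) :
    D \subset pairs setT -> 16 * m * M <= #|D| -> 128 * #|T| <= m * m ->
  rare M.-1 [set f : sample | [exists Q, packing (present f) Q
                  && (#|D :&: (present f :\: cover Q)| <= M)]].
Proof.
(* Trimming [D] to exactly [16 * m * M] pairs suits both tails: it equals [4 * m * (4 * M)], and
   [8 * (16 * m * M) * #|T| <= M * m ^ 3] by the bound on [128 * #|T|]. *)
move=> sD /subset_of_card[D' sD' cD'] le_m.
case: M => [|M] in cD' *; first by rewrite /rare muln1 -card_sample max_card.
set A := [set f : sample | #|D' :&: present f| <= 4 * M.+1].
set B := [set f : sample | [exists P : {set {set {set T}}},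
  [&& P \subset triangles_meeting D', #|P| == M.+1, trivIset P
    & cover P \subset present f]]].
apply: (@rare_sub _ _ _ _ (A :|: B)).
  apply/subsetP=> f; rewrite !inE => /existsP[Q /andP[pkQ]].
  apply: contraLR; rewrite negb_or -!ltnNge => /andP[ltA noB].
  apply: leq_trans (packing_survivors pkQ noB ltA) _.
  by apply/subset_leq_card/setSI.
(* The union of two events costs the one unit in [M.-1]. *)
apply: rareU; last first.
  apply: (@rare_packing _ _ _ 3) => [C /setIdP[] /card_triangle // |].
  apply: (@leq_trans (8 * (#|D'| * #|T|))).
    by rewrite leq_mul // card_triangles_meeting // (subset_trans sD').
  by rewrite cD' !expnS expn0 muln1; nia.
apply: (@rareW _ _ (4 * M.+1)); first by lia.
by apply: rare_few_present; rewrite cD'; lia.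
Qed.

(** The packing bound applied to singletons of pairs, which are automatically disjoint; there are at
    most [a * a] of them. *)
Lemma rare_dense_cross (A B : {set T}) (a t : nat) :
    #|A| = a -> #|B| = a -> 8 * a <= t * m ->
  rare (t * a) [set f : sample | t * a <= #|cross A B :&: present f|].
Proof.
move=> cA cB le_t.
set F := [set [set p] | p in cross A B].
have set1I : injective (@set1 {set T}) by exact: set1_inj.
apply: rare_sub (@rare_packing _ m' F 1 (t * a) _ _).
- apply/subsetP=> f; rewrite !inE => /subset_of_card[P sP cP].
  have sPA := subset_trans sP (subsetIl _ _).
  apply/existsP; exists [set [set p] | p in P].
  rewrite imsetS //= card_imset // cP eqxx /=; apply/andP; split.
    apply/trivIsetP=> _ _ /imsetP[p _ ->] /imsetP[q _ ->] neq.
    by rewrite disjoints1 inE; apply: contraNneq neq => ->.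
  apply/bigcupsP=> _ /imsetP[p pP ->]; rewrite sub1set.
  by have /setIP[] := subsetP sP p pP.
- by move=> _ /imsetP[p _ ->]; rewrite cards1.
- have leF: #|F| <= a * a.
    by rewrite card_imset // (leq_trans (leq_imset_card _ _)) // cardsX cA cB.
  rewrite expn1 mulnAC (leq_trans (leq_mul (leqnn 8) leF)) //.
  by rewrite mulnA leq_mul.
Qed.

End RandomGraph.

Lemma exists_semi_bipartite_sparse (T : finType) (m' L M : nat) :
    #|T| <= 2 ^ L -> 3 <= L -> L + 4 <= M ->
    128 * #|T| <= m'.+1 * m'.+1 -> 16 * m'.+1 * M <= #|T|.-1 ->
  exists e : rel T,
    [/\ simple_graph e, triangle_free e, forall v, M < degree e v &
        forall V1 V2 : {set T}, [disjoint V1 & V2] -> stable e V1 ->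
          V1 :|: V2 != set0 ->
        exists2 v, v \in V1 :|: V2 & degree (bip e V1 V2) v < 512 * L].
Proof.
set m := m'.+1 => leT L3 leM le_m leMT.
(* This makes ['C(k, 2)] equal to [16 * m * (2 * L * k)], with exponent [2 * L * k] twice the
   [L * k] paid for choosing a [k]-set. *)
pose k := (64 * m * L).+1.
pose sparse (D : {set {set T}}) (M : nat) := [set f : sample {set T} m' |
  [exists Q, packing (present f) Q && (#|D :&: (present f :\: cover Q)| <= M)]].
pose sets a := [set S : {set T} | #|S| == a].
pose dense a (x : {set T} * {set T}) := [set f : sample {set T} m' |
  512 * L * a <= #|cross x.1 x.2 :&: present f|].
have le_sets a : #|sets a| <= 2 ^ (L * a).
  rewrite card_draws (leq_trans (bin_leq_exp _ _)) // expnM.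
  by case: a => // a; rewrite leq_exp2r.
have rare_star : rare 2 (\bigcup_(v in [set: T]) sparse (star v) M).
  apply: (@rare_bigcup _ _ _ _ _ L) => [|v _]; first by rewrite cardsT.
  apply: (@rareW _ _ M.-1); first by lia.
  by apply: rare_few_survivors; rewrite ?star_pairs ?card_star.
have rare_pairs :
    rare 3 (\bigcup_(S in sets k) sparse (pairs S) (2 * L * k)).
  apply: (@rare_bigcup _ _ _ _ _ (L * k)) => [//|S]; rewrite inE => /eqP cS.
  have le6Lk : 3 * 2 <= L * k by rewrite leq_mul // /k ltnS !muln_gt0 (ltnW (ltnW L3)).
  apply: (@rareW _ _ (2 * L * k).-1).
    by move: le6Lk; rewrite -mulnA; move: (L * k); lia.
  apply: rare_few_survivors => //.
    by apply/subsetP=> p; rewrite !inE subsetT => /andP[].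
  rewrite card_pairs cS bin2 /k /=.
  have ->: k * (64 * m * L) = (16 * m * (2 * L * k)).*2 by rewrite -mul2n; lia.
  by rewrite doubleK.
(* Size 0 is excluded because [dense 0 x] always holds; an empty [V1] is treated separately. *)
pose sizes := [set a : 'I_#|T|.+1 | 0 < a < k].
have rare_cross : rare 3
    (\bigcup_(a in sizes) \bigcup_(x in setX (sets a) (sets a)) dense a x).
  apply: (@rare_bigcup _ _ _ _ _ L.+1) => [|a].
    rewrite (leq_trans (max_card _)) // card_ord expnS.
    by have := expn_gt0 2 L; lia.
  rewrite inE => /andP[a_gt0 ltak].
  apply: (@rare_bigcup _ _ _ _ _ (L * a + L * a)) => [|[A B]].
    by rewrite cardsX expnD leq_mul.
  rewrite !inE /= => /andP[/eqP cA /eqP cB].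
  have La : L <= L * a by rewrite leq_pmulr.
  apply: (@rareW _ _ (512 * L * a)).
    by rewrite -mulnA; move: (L * a) La L3 => y; clear; lia.
  (* From [a <= 64 * m * L] follows [8 * a <= 512 * L * m], whence the constant 512. *)
  by apply: rare_dense_cross => //; move: ltak; rewrite /k -/m; lia.
(* The failure probabilities [1/4], [1/8] and [1/8] add up to [1/2]. *)
have [f] := rare_exists (rareU rare_star (rareU rare_pairs rare_cross)).
rewrite !inE !negb_or => /and3P[noStar noPairs noCross].
have [Q [pkQ tfQ]] := packing_triangle_free (present f).
set H := present f :\: cover Q in tfQ.
have survive D (N : nat) : f \notin sparse D N -> N < #|D :&: H|.
  rewrite ltnNge; apply: contra => leH.
  by rewrite inE; apply/existsP; exists Q; rewrite pkQ.
exists (adj H); split=> // [|v|V1 V2 dV stV1 neV]; first exact: adj_simple.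
  apply: leq_trans (card_star_degree H v); apply: survive.
  by apply: contra noStar => fv; apply/bigcupP; exists v.
have ltV1 : #|V1| < k.
  rewrite ltnNge; apply/negP=> /subset_of_card[S sS cS].
  have /survive/(leq_ltn_trans (leq0n _)) : f \notin sparse (pairs S) (2 * L * k).
    by apply: contra noPairs => fS; apply/bigcupP; exists S; rewrite // inE cS.
  rewrite card_gt0 => /set0Pn[p /setIP[]]; rewrite inE => /andP[sp].
  case/cards2P=> x [y [nxy ep]] pH; move: sp; rewrite ep subUset !sub1set.
  case/andP=> /(subsetP sS) xV /(subsetP sS) yV.
  by have := stV1 x y xV yV; rewrite /adj /= nxy -ep pH.
apply/exists_inP; apply: contraT => /exists_inPn degV.
have {}degV v : v \in V1 :|: V2 -> 512 * L <= degree (bip (adj H) V1 V2) v.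
  by move=> vV; rewrite leqNgt degV.
have [V10 | V1_neq0] := eqVneq V1 set0.
  case/set0Pn: neV => v vV; have := degV v vV; rewrite leqNgt => /negP[].
  rewrite (_ : degree _ _ = 0); first by rewrite muln_gt0 (ltnW (ltnW L3)).
  by apply: eq_card0 => u; rewrite inE /bip /= V10 !inE /= !andbF.
have [B cB le_cross] := semi_bipartite_cross dV degV.
case/negP: noCross; have ltV1T : #|V1| < #|T|.+1 by rewrite ltnS max_card.
apply/bigcupP; exists (Ordinal ltV1T); first by rewrite inE /= card_gt0 V1_neq0.
apply/bigcupP; exists (V1, B); first by rewrite !inE /= cB eqxx.
rewrite inE /= (leq_trans le_cross) //.
by apply/subset_leq_card/setIS/subsetDl.
Qed.

(** * Choice of the parameters for large [n] *)

Lemma sqr_leq_exp2 (j : nat) : (j + 35) ^ 2 <= 2 ^ (j + 12).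
Proof.
elim: j => [|j IHj]; first by [].
by rewrite addSn [2 ^ (_ + 12).+1]expnS; move: IHj; rewrite -!mulnn; nia.
Qed.

Lemma random_graph_parameters : exists N, forall n, N <= n ->
  exists m' L, let m := m'.+1 in
    [/\ 2 ^ L.-1 < n <= 2 ^ L, 3 <= L, L + 4 <= n.-1 %/ (16 * m),
        128 * n <= m * m & m * m <= 512 * n].
Proof.
exists (2 ^ 30) => n leN.
have n_gt1 : 1 < n by apply: leq_trans leN; rewrite -[1]/(2 ^ 0) ltn_exp2l.
have [lt_n le_n] := andP (up_log_bounds (ltnSn 1) n_gt1).
set L := up_log 2 n in lt_n le_n.
have L30 : 30 <= L by rewrite -(@leq_exp2l 2) // (leq_trans leN).
have ex_m : exists m, 128 * n <= m * m by exists (128 * n); nia.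
case: (ex_minnP ex_m) => -[|m'] le_m min_m; first by lia.
have m_ub : m'.+1 * m'.+1 <= 512 * n.
  have := contraNN (min_m m'); rewrite -ltnNge -ltnNge => /(_ (ltnSn m')).
  by nia.
exists m', L; split=> //; [by rewrite lt_n | by lia |].
rewrite leq_divRL //.
(* Raising [L + 4] to [L + 5] absorbs the predecessor in [n.-1]. Squaring then reduces the claim to
   [m * m <= 512 * n] and [256 * 512 * (L + 5) ^ 2 <= n]. *)
suff: 16 * m'.+1 * (L + 5) <= n by lia.
rewrite -leq_sqr expnMn.
have sqL : 256 * 512 * (L + 5) ^ 2 <= n.
  rewrite (leq_trans _ (ltnW lt_n)) //.
  have -> : L.-1 = 8 + 9 + (L - 30 + 12) by lia.
  rewrite expnD (expnD 2 8) leq_mul //.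
  have -> : L + 5 = L - 30 + 35 by lia.
  exact: sqr_leq_exp2.
rewrite -!mulnn in sqL *; nia.
Qed.
Local Close Scope nat_scope.

Theorem theorem3p2 (R : realType) :
  exists delta gamma : R, [/\ 0 < delta, 0 < gamma &
    exists N : nat, forall n : nat, (N <= n)%N ->
      exists e : rel 'I_n,
        [/\ simple_graph e,
            triangle_free e,
            min_degree_ge e [set: 'I_n] (delta * Num.sqrt n%:R) &
            ~ has_semi_bipartite_induced e (gamma * ln n%:R)]].
Proof.
have ln2_gt0 : 0 < ln 2 :> R by rewrite ln_gt0 // ltr1n.
exists (1024%:R^-1), (1024%:R / ln 2); split.
- by rewrite invr_gt0 ltr0n.
- by rewrite divr_gt0 ?ltr0n.
have [N params] := random_graph_parameters; exists N => n /params.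
case=> m' [L [/andP[lt_n le_n] L3 leM le_m m_ub]].
set M := (n.-1 %/ (16 * m'.+1))%N in leM.
have [|||||e [simp_e tf_e deg_e sparse_e]] :=
  @exists_semi_bipartite_sparse 'I_n m' L M; rewrite ?card_ord //.
  by rewrite mulnC leq_divM.
exists e; split=> // [v _ | [V' [V'_neq0 [V1 [V2 [[defV' dV stV1] degV]]]]]].
  (* Squaring [n <= 32 * m * M] and using [m * m <= 512 * n] gives [n <= 2 ^ 19 * M ^ 2]. *)
  have n_le : (n <= (1024 * M) ^ 2)%N.
    have lt_nM : (n.-1 < M.+1 * (16 * m'.+1))%N by rewrite ltn_ceil.
    have le_nM : (n <= 32 * m'.+1 * M)%N by nia.
    have n_gt0 : (0 < n)%N by apply: leq_trans lt_n.
    rewrite -(leq_pmul2l n_gt0) (leq_trans (leq_mul le_nM le_nM)) //.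
    by rewrite -mulnn; nia.
  rewrite mulrC ler_pdivrMr ?ltr0n //.
  apply: (@le_trans _ _ (1024 * M)%:R).
    by rewrite -(@ler_pXn2r _ 2) ?nnegrE ?sqrtr_ge0 // sqr_sqrtr // -natrX ler_nat.
  by rewrite mulnC natrM ler_pM2r ?ltr0n // ler_nat ltnW.
have [|||v vV] := sparse_e V1 V2 => //; first by rewrite defV'.
rewrite ltnNge => /negP; apply; rewrite -(ler_nat R).
apply: le_trans (degV v _); last by rewrite -defV'.
(* As [512 * L <= 1024 * (L - 1)], this yields [gamma = 1024 / ln 2]. *)
have lnn : L.-1%:R * ln 2 <= ln n%:R :> R.
  rewrite mulr_natl -lnXn ?ltr0n // -natrX ler_ln ?posrE ?ltr0n ?expn_gt0 //.
    by rewrite ler_nat ltnW.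
  by apply: leq_trans lt_n.
rewrite mulrAC ler_pdivlMr //.
apply: (@le_trans _ _ (1024%:R * (L.-1%:R * ln 2))); last by rewrite ler_pM2l ?ltr0n.
by rewrite mulrA ler_pM2r // -natrM ler_nat; lia.
Qed.
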